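(* A fanning curve $\ell(t)$ in the Grassmannian $\mathrm{G}_n$ of $n$-dimensional subspaces of $\mathbb{R}^{2n}$ is weakly parallel if and only if it is of the form $\ell(t)=\exp(t\mathbf{X})\ell(0)$, where $\mathbf{X}$ is a linear transformation of $\mathbb{R}^{2n}$ such that $\mathbf{X}\ell(0)$ is transverse to $\ell(0)$.
   Context: A fanning frame is a smooth curve $\mathcal{A}(t)$, $t\in\mathbb{R}$, of real $2n\times n$ matrices such that the $2n\times 2n$ matrix $(\mathcal{A}(t)|\dot{\mathcal{A}}(t))$ obtained by juxtaposition is invertible for all $t$. A fanning curve is a smooth curve $\ell(t)$ in $\mathrm{G}_n$ that is the column span of a fanning frame. For a fanning frame there are unique smooth curves of $n\times n$ matrices $P(t),Q(t)$ with $\ddot{\mathcal{A}}+\dot{\mathcal{A}}P(t)+\mathcal{A}Q(t)=O$; the Schwarzian of $\mathcal{A}(t)$ is $\{\mathcal{A}(t),t\}=2Q(t)-\tfrac12P(t)^2-\dot P(t)$. A fanning frame is normal if for all $t$ the columns of $\ddot{\mathcal{A}}(t)$ are linear combinations of those of $\mathcal{A}(t)$. A fanning curve $\ell(t)$ is weakly parallel if whenever $\mathcal{A}(t)$ is a normal frame spanning $\ell(t)$, there exist constant $n\times n$ matrices $X$ and $Y$ such that $\{\mathcal{A}(t),t\}=\exp(-tY)\,X\,\exp(tY)$ for all $t$. Transverse means that $\mathbf{X}\ell(0)$ and $\ell(0)$ together span $\mathbb{R}^{2n}$ (so that $\mathbb{R}^{2n}=\ell(0)\oplus\mathbf{X}\ell(0)$).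 *)

(* Defs.v *)
From mathcomp Require Import all_boot all_order all_algebra.
From mathcomp Require Import all_classical all_reals all_analysis.

Set Implicit Arguments.
Unset Strict Implicit.
Unset Printing Implicit Defensive.

Import Order.TTheory GRing.Theory Num.Theory.
Import numFieldNormedType.Exports.

Local Open Scope classical_set_scope.
Local Open Scope ring_scope.

Section Curves.
Context {R : realType}.

Definition smooth {V : normedModType R} (f : R -> V) : Prop :=
  forall (k : nat) (t : R), derivable (derive1n k f) t 1.

(* The limit is taken in the normed space of m x m matrices. *)
Definition expmx {m : nat} (M : 'M[R]_m) : 'M[R]_m :=
  limn (series (fun k : nat => (k`!%:R)^-1 *: M ^+ k)).

Definition colspan {m p : nat} (M : 'M[R]_(m, p)) : {vspace 'cV[R]_m} :=
  <<[seq col j M | j : 'I_p]>>%VS.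

Definition mximg {m : nat} (M : 'M[R]_m) (U : {vspace 'cV[R]_m}) :
    {vspace 'cV[R]_m} :=
  (linfun (mulmx M) @: U)%VS.

End Curves.

Record grassmannian (R : realType) (n : nat) := Grassmannian {
  gr_space :> {vspace 'cV[R]_(n + n)};
  gr_dim : \dim gr_space = n }.

Section Fanning.
Context {R : realType} {n : nat}.
Implicit Types (A : R -> 'M[R]_(n + n, n)) (P Q S : R -> 'M[R]_n).
Implicit Types (ell : R -> grassmannian R n).

Definition fanning_frame A : Prop :=
  smooth A /\ forall t, row_mx (A t) (derive1 A t) \in unitmx.

Definition spans A ell : Prop :=
  forall t, colspan (A t) = ell t.

(* A curve in the Grassmannian spanned by a smooth frame is smooth, so
   smoothness of ell is not a separate requirement. *)
Definition fanning_curve ell : Prop :=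
  exists A, fanning_frame A /\ spans A ell.

Definition frame_equation A P Q : Prop :=
  forall t, derive1n 2 A t + derive1 A t *m P t + A t *m Q t = 0.

(* S is the Schwarzian of A; it is unique for a fanning frame, see
   is_schwarzian_inj below. *)
Definition is_schwarzian A S : Prop :=
  exists P Q, [/\ smooth P, smooth Q, frame_equation A P Q
    & forall t, S t = 2%:R *: Q t - 2^-1 *: (P t *m P t) - derive1 P t].

Definition normal_frame A : Prop :=
  fanning_frame A /\
  forall (t : R) (j : 'I_n), col j (derive1n 2 A t) \in colspan (A t).

Definition weakly_parallel ell : Prop :=
  forall A, normal_frame A -> spans A ell ->
  exists X Y : 'M[R]_n,
    is_schwarzian A (fun t => expmx (- t *: Y) *m X *m expmx (t *: Y)).

Definition transverse (U V : {vspace 'cV[R]_(n + n)}) : Prop :=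
  (U + V)%VS = fullv.

Lemma frame_equation_inj A P Q P' Q' : fanning_frame A ->
  frame_equation A P Q -> frame_equation A P' Q' -> P = P' /\ Q = Q'.
Proof.
move=> [_ Au] e e'.
suff PQ t : col_mx (Q t) (P t) = col_mx (Q' t) (P' t).
  by split; apply/funext => t; have /eq_col_mx[] := PQ t.
apply: (can_inj (mulKmx (Au t))); rewrite !mul_row_col.
apply: (addrI (derive1n 2 A t)).
by rewrite !(addrC (A t *m _)) !addrA e e'.
Qed.

Lemma is_schwarzian_inj A S S' : fanning_frame A ->
  is_schwarzian A S -> is_schwarzian A S' -> S = S'.
Proof.
move=> Af [P [Q [_ _ e eS]]] [P' [Q' [_ _ e' eS']]].
have [PP' QQ'] := frame_equation_inj Af e e'.
by apply/funext => t; rewrite eS eS' PP' QQ'.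
Qed.

End Fanning.

(* Main.v *)
Require Import Defs.
From mathcomp Require Import all_boot all_order all_algebra.
From mathcomp Require Import all_classical all_reals all_analysis.
From mathcomp Require Import ring lra.

(** A normal frame is obtained from a fanning frame [A] with
    [A'' + A' P + A Q = 0] by solving [M' = P M / 2] and taking [A M]; the
    global solution of this linear equation comes from Picard iteration.

    If a normal frame [B] satisfies [B'' = - B S / 2] with
    [S = exp(- t Y) X exp(t Y)], then [D = B exp(- t Y)] spans the same curve
    and satisfies an equation [D'' + D' P + D Q = 0] with constant coefficients,
    so [(D | D')] equals [exp(t Z) (D(0) | D'(0))] for a constant matrix [Z].

    Conversely, along an orbit [exp(t X) l(0)] with [A0] a basis of [l(0)] and
    [X^2 A0 + X A0 P + A0 Q = 0], the normal frames starting at [A0] are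
    [exp(t X) A0 exp(t P / 2)], whose Schwarzian is
    [exp(- t P / 2) (2 Q - P^2 / 2) exp(t P / 2)]. *)

Import Order.TTheory GRing.Theory Num.Theory.
Import numFieldNormedType.Exports.

Set Implicit Arguments.
Unset Strict Implicit.

Local Open Scope classical_set_scope.
Local Open Scope ring_scope.

(** * Increments and primitives of real functions *)

Section Scalar.
Context {R : realType}.
Implicit Types (f g df dg : R -> R) (t : R).

Lemma is_derive_continuous f (a t : R) : is_derive t 1 f a ->
  {for t, continuous f}.
Proof. by move=> [+ _] => /derivable1_diffP/differentiable_continuous. Qed.

Lemma is_derive_sumE (I : finType) (h : I -> R -> R) (dh : I -> R) (t : R) :
  (forall i, is_derive t 1 (h i) (dh i)) ->
  is_derive t 1 (fun s => \sum_i h i s) (\sum_i dh i).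
Proof.
move=> hd; rewrite [X in is_derive _ _ X _](_ : _ = \sum_i h i); last first.
  by apply/funext => s; rewrite fct_sumE.
elim/big_ind2 : _ => // [|*]; [exact: is_derive_cst|exact: is_deriveD].
Qed.

Lemma continuous_sumE (I : finType) (h : I -> R -> R) :
  (forall i, continuous (h i)) -> continuous (fun s => \sum_i h i s).
Proof.
move=> hc; rewrite (_ : (fun s => _) = \sum_i h i); last first.
  by apply/funext => s; rewrite fct_sumE.
elim/big_ind : _ => // [t|f g fc gc t]; first exact: cvg_cst.
by apply: continuousD; [exact: fc|exact: gc].
Qed.

(** Mean value theorem for [f - g] on [0, t]: its increment is [t] times a nonpositive value of the
    derivative. *)
Lemma le_increment f df g dg t : 0 <= t ->
  (forall s, 0 <= s <= t -> is_derive s 1 f (df s)) ->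
  (forall s, 0 <= s <= t -> is_derive s 1 g (dg s)) ->
  (forall s, 0 <= s <= t -> df s <= dg s) ->
  f t - f 0 <= g t - g 0.
Proof.
move=> t0 fd gd fg.
have hd s : 0 <= s <= t -> is_derive s 1 (f - g) (df s - dg s).
  by move=> st; apply: is_deriveB; [exact: fd|exact: gd].
have [|||c] := @MVT_segment R (f - g) (fun s => df s - dg s) 0 t.
- exact: t0.
- by move=> s /[!in_itv] /= /andP[s0 st]; apply: hd; rewrite !ltW.
- apply: derivable_within_continuous => s; rewrite in_itv /= => st.
  by have [] := hd _ st.
rewrite in_itv /= => /fg; rewrite -subr_le0 subr0 => fgc e.
have : (df c - dg c) * t <= 0 by apply: mulr_le0_ge0.
rewrite -e -![(f - g) _]/(f _ - g _); lra.
Qed.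

(** Comparison of [f] with plus and minus c s^(k+1) / (k+1), whose derivative is c s^k. Iterating
    this bound produces the factorials in the Picard estimate; the case k = 0 is the plain mean
    value bound. *)
Lemma norm_increment_le f df (c t : R) (k : nat) :
  (forall s : R, `|s| <= `|t| -> is_derive s 1 f (df s)) ->
  (forall s : R, `|s| <= `|t| -> `|df s| <= c * `|s| ^+ k) ->
  `|f t - f 0| <= c * `|t| ^+ k.+1 / k.+1%:R.
Proof.
(* Negative [t] is reduced to positive [t] by the reflection s -> -s, which preserves both
   bounds. *)
wlog t0 : f df t / 0 <= t.
  move=> H; have [|/ltW t0] := leP 0 t; first exact: H.
  move=> fd fc; have := H (f \o -%R) (fun s => df (- s) * -1) (- t).
  rewrite oppr_ge0 /= opprK oppr0 normrN; apply=> // s st.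
  - by apply: is_derive1_comp; apply: fd; rewrite normrN.
  - by rewrite mulrN1 normrN -[`|s|]normrN; apply: fc; rewrite normrN.
rewrite (ger0_norm t0) => fd fc.
pose h s : R := c * s ^+ k.+1 / k.+1%:R.
have hd (s : R) : is_derive s 1 h (c * s ^+ k).
  rewrite [h](_ : _ = (c / k.+1%:R) *: (id : R -> R) ^+ k.+1); last first.
    by apply/funext => u; rewrite /h -[RHS]/(_ * _) fctE mulrAC.
  by apply: is_derive_eq; rewrite /GRing.scale /= mulr1 mulrA divfK ?pnatr_eq0.
have h0 : h 0 = 0 by rewrite /h expr0n mulr0 mul0r.
have st s : 0 <= s <= t -> `|s| <= t /\ `|s| = s.
  by move=> /andP[s0 st]; rewrite ger0_norm.
have fb s : 0 <= s <= t -> - (c * s ^+ k) <= df s <= c * s ^+ k.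
  by move=> /st [s1 s2]; rewrite -ler_norml -{2}s2 fc.
rewrite -[X in _ <= X]/(h t) ler_norml; apply/andP; split.
- have := @le_increment (- h) (fun s => - (c * s ^+ k)) f df t t0.
  rewrite -![(- h) _]/(- h _) h0 oppr0 subr0; apply.
  + by move=> s /st[? _]; exact: fd.
  + by move=> s /fb /andP[].
- have := @le_increment f df h (fun s => c * s ^+ k) t t0.
  rewrite h0 subr0; apply.
  + by move=> s /st[? _]; exact: fd.
  + by move=> s /fb /andP[].
Qed.

Lemma is_derive0_eq f t :
  (forall s : R, `|s| <= `|t| -> is_derive s 1 f 0) -> f t = f 0.
Proof.
move=> fd; apply/eqP; rewrite -subr_eq0 -normr_le0.
have := @norm_increment_le f (fun=> 0) 0 t 0%N fd.
by rewrite !mul0r; apply=> s _; rewrite normr0 mul0r.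
Qed.

(** The integral from -T is a primitive to the right of -T only. Normalized to vanish at 0, the
    primitives for different T agree where both are valid, so choosing T = |x| + 1 at each point x
    glues them into one function on the line. *)
Lemma antiderivative f : continuous f ->
  exists F : R -> R, F 0 = 0 /\ forall t, is_derive t 1 F (f t).
Proof.
move=> cf.
pose G (T x : R) : R := (\int[lebesgue_measure]_(s in `[- T, x]) f s)%R.
have Gd (T x : R) : - T < x -> is_derive x 1 (G T) (f x).
  move=> Tx; have x1 : x < x + 1 by rewrite ltrDl.
  have [|] := @continuous_FTC1_closed R f (- T) x (x + 1) x1 _ Tx (cf x).
    apply: continuous_compact_integrable; first exact: segment_compact.
    exact/continuous_subspaceT.
  by move=> ? <-; rewrite derive1E; exact: derivableP.
pose H (T x : R) : R := G T x - G T 0.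
have Hd (T x : R) : `|x| < T -> is_derive x 1 (H T) (f x).
  rewrite ltr_norml => /andP[Tx _].
  rewrite -[f x]subr0; apply: is_deriveB; exact: Gd.
have HE (S T x : R) : `|x| < S -> `|x| < T -> H S x = H T x.
  move=> xS xT; apply/eqP; rewrite -subr_eq0; apply/eqP.
  transitivity ((H S - H T) 0); last first.
    by rewrite -[LHS]/(H S 0 - H T 0) /H !subrr.
  apply: (@is_derive0_eq (H S - H T)) => s sx; rewrite -[0](subrr (f s)).
  by apply: is_deriveB; apply: Hd; apply: le_lt_trans sx _.
exists (fun x => H (`|x| + 1) x); split; first by rewrite /H subrr.
move=> t; apply: near_eq_is_derive (Hd (`|t| + 1) t _); last by rewrite ltrDl.
have : \forall s \near t, `|s| < `|t| + 1.
  have /(_ t) := @norm_continuous _ R; move/cvgr_lt; apply; by rewrite ltrDl.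
by apply: filterS => s st; apply: HE => //; rewrite ltrDl.
Qed.

End Scalar.

(** * Entrywise calculus of matrix curves *)

Section MatrixCalculus.
Context {R : realType}.

(** Stated entry by entry so that the scalar rules apply; [mxderivP] identifies it with the
    derivative in the normed space of matrices. *)
Definition mxderiv {m n} (F F' : R -> 'M[R]_(m, n)) : Prop :=
  forall (t : R) i j, is_derive t 1 (fun s => F s i j) (F' t i j).

Lemma mxderivP {m n} (F F' : R -> 'M[R]_(m, n)) :
  mxderiv F F' <-> (forall t, derivable F t 1) /\ derive1 F = F'.
Proof.
split=> [Fd|[Fd <-]].
  have dF t : derivable F t 1.
    by apply/derivable_mxP => i j; have [] := Fd t i j.
  split=> //; apply/funext => t; apply/matrixP => i j.
  by rewrite derive1E derive_mx// mxE; have [_] := Fd t i j.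
move=> t i j; rewrite derive1E derive_mx// mxE.
by apply: derivableP; apply: (derivable_mxP _ _ _).1.
Qed.

Lemma eq_mxderiv {m n} (F F' G' : R -> 'M[R]_(m, n)) :
  mxderiv F F' -> (forall t, F' t = G' t) -> mxderiv F G'.
Proof. by move=> + /funext <-. Qed.

Lemma mxderiv_cst {m n} (C : 'M[R]_(m, n)) : mxderiv (fun=> C) (fun=> 0).
Proof. by move=> t i j; rewrite mxE; exact: is_derive_cst. Qed.

Lemma mxderivD {m n} (F F' G G' : R -> 'M[R]_(m, n)) :
  mxderiv F F' -> mxderiv G G' ->
  mxderiv (fun t => F t + G t) (fun t => F' t + G' t).
Proof.
move=> Fd Gd t i j; rewrite mxE.
rewrite [X in is_derive _ _ X _](_ : _ = (fun s => F s i j) + fun s => G s i j).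
  by apply: is_deriveD; [exact: Fd|exact: Gd].
by apply/funext => s; rewrite mxE.
Qed.

Lemma mxderivZ {m n} (a : R) (F F' : R -> 'M[R]_(m, n)) :
  mxderiv F F' -> mxderiv (fun t => a *: F t) (fun t => a *: F' t).
Proof.
move=> Fd t i j; rewrite mxE.
rewrite [X in is_derive _ _ X _](_ : _ = a *: (fun s => F s i j)).
  by apply: is_deriveZ; exact: Fd.
by apply/funext => s; rewrite mxE.
Qed.

Lemma mxderivM {m n p} (F F' : R -> 'M[R]_(m, n)) (G G' : R -> 'M[R]_(n, p)) :
  mxderiv F F' -> mxderiv G G' ->
  mxderiv (fun t => F t *m G t) (fun t => F' t *m G t + F t *m G' t).
Proof.
move=> Fd Gd t i j.
rewrite [X in is_derive _ _ X _](_ : _ =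
    (fun s => \sum_k ((fun s => F s i k) * (fun s => G s k j)) s)); last first.
  by apply/funext => s; rewrite mxE.
rewrite !mxE -big_split /=; apply: is_derive_sumE => k.
apply: is_derive_eq; first by apply: is_deriveM; [exact: Fd|exact: Gd].
by rewrite /GRing.scale /= addrC; congr (_ + _); exact: mulrC.
Qed.

Lemma mxderiv_row {m n p} (F F' : R -> 'M[R]_(m, n))
    (G G' : R -> 'M[R]_(m, p)) :
  mxderiv F F' -> mxderiv G G' ->
  mxderiv (fun t => row_mx (F t) (G t)) (fun t => row_mx (F' t) (G' t)).
Proof.
move=> Fd Gd t i j; rewrite mxE.
case: split_ordP => k -> {j}.
  rewrite [X in is_derive _ _ X _](_ : _ = (fun s => F s i k)); first exact: Fd.
  by apply/funext => s; rewrite row_mxEl.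
rewrite [X in is_derive _ _ X _](_ : _ = (fun s => G s i k)); first exact: Gd.
by apply/funext => s; rewrite row_mxEr.
Qed.

Lemma mxderiv_tr {m n} (F F' : R -> 'M[R]_(m, n)) :
  mxderiv F F' -> mxderiv (fun t => (F t)^T) (fun t => (F' t)^T).
Proof.
move=> Fd t i j; rewrite mxE.
rewrite [X in is_derive _ _ X _](_ : _ = (fun s => F s j i)); first exact: Fd.
by apply/funext => s; rewrite mxE.
Qed.

Lemma mxderiv0_cst {m n} (F : R -> 'M[R]_(m, n)) :
  mxderiv F (fun=> 0) -> forall t, F t = F 0.
Proof.
move=> Fd t; apply/matrixP => i j.
apply: (@is_derive0_eq R (fun s => F s i j)) => s _.
by have := Fd s i j; rewrite mxE.
Qed.

Lemma mxderiv_continuous {m n} (F F' : R -> 'M[R]_(m, n)) i j :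
  mxderiv F F' -> continuous (fun t => F t i j).
Proof. by move=> Fd t; exact: is_derive_continuous (Fd t i j). Qed.

Lemma mx_antiderivative {m n} (F : R -> 'M[R]_(m, n)) :
  (forall i j, continuous (fun t => F t i j)) ->
  exists2 G, G 0 = 0 & mxderiv G F.
Proof.
move=> Fc; have aF i j := antiderivative (Fc i j).
exists (fun t => \matrix_(i, j) projT1 (cid (aF i j)) t).
  by apply/matrixP => i j; rewrite !mxE; have [] := projT2 (cid (aF i j)).
move=> t i j; rewrite (_ : (fun t => _) = projT1 (cid (aF i j))).
  by have [] := projT2 (cid (aF i j)).
by apply/funext => s; rewrite mxE.
Qed.

Lemma continuous_mulmx {m n p} (F : R -> 'M[R]_(m, n)) (G : R -> 'M[R]_(n, p)) :
  (forall i j, continuous (fun t => F t i j)) ->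
  (forall i j, continuous (fun t => G t i j)) ->
  forall i j, continuous (fun t => (F t *m G t) i j).
Proof.
move=> Fc Gc i j.
rewrite (_ : (fun t => _) = fun t => \sum_k F t i k * G t k j); last first.
  by apply/funext => t; rewrite mxE.
by apply: continuous_sumE => k t; apply: continuousM; [exact: Fc|exact: Gc].
Qed.

End MatrixCalculus.

(** * Linear differential equations *)

Section Picard.
Context {R : realType} {m n : nat}.
(** [u k] is the k-th increment of the Picard iteration for M' = P M, M(0) = C. Keeping [u] abstract
    lets one convergence argument serve both the general linear equation and the exponential
    series. *)
Variables (P : R -> 'M[R]_m) (u : nat -> R -> 'M[R]_(m, n)) (C : 'M[R]_(m, n)).
Hypothesis P_cont : forall i j, continuous (fun t => P t i j).
Hypothesis u0 : forall t, u 0 t = C.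
Hypothesis uS0 : forall k, u k.+1 0 = 0.
Hypothesis u_deriv : forall k, mxderiv (u k.+1) (fun t => P t *m u k t).

Lemma mulmx_locally_bounded (T : R) : exists2 c : R, 0 <= c &
  forall (t : R) (v : 'M[R]_(m, n)) (b : R), `|t| <= T ->
  (forall i j, `|v i j| <= b) -> forall i j, `|(P t *m v) i j| <= c * b.
Proof.
have bP i j : exists c : R, forall t, `|t| <= T -> `|P t i j| <= c.
  have /compact_bounded[c [_ cP]] :=
    @continuous_compact _ _ (fun t => P t i j) `[- T, T]
      (continuous_subspaceT (@P_cont i j)) (@segment_compact _ _ _).
  exists (c + 1) => t tT; apply: (cP (c + 1)); first by rewrite ltrDl.
  by exists t => //=; rewrite in_itv /= -ler_norml.
pose c i j := projT1 (cid (bP i j)).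
have cP i j (t : R) : `|t| <= T -> `|P t i j| <= `|c i j|.
  by move=> tT; apply: le_trans (ler_norm _); exact: (projT2 (cid (bP i j))).
(* The sum of the bounds of all entries dominates every row sum, hence bounds the action of [P t]
   for the largest-entry norm. *)
exists (\sum_i \sum_j `|c i j|); first by do 2![apply: sumr_ge0 => ? _].
move=> t v b tT vb i j; rewrite mxE.
have b0 : 0 <= b := le_trans (normr_ge0 _) (vb i j).
apply: (@le_trans _ _ (\sum_k `|c i k| * b)).
  apply: le_trans (ler_norm_sum _ _ _) _; apply: ler_sum => k _.
  by rewrite normrM ler_pM ?cP.
rewrite -mulr_suml; apply: ler_wpM2r; first exact: b0.
by rewrite [leRHS](bigD1 i) //= lerDl; do 2![apply: sumr_ge0 => ? _].
Qed.

Let S (N : nat) (t : R) : 'M[R]_(m, n) := \sum_(k < N) u k t.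

Let SS N t : S N.+1 t = S N t + u N t.
Proof. by rewrite /S big_ord_recr. Qed.

(** The partial sums are the Picard iterates; the empty sum [S 0] is zero, which matches the
    constant [S 1]. *)
Let S_deriv N : mxderiv (S N.+1) (fun t => P t *m S N t).
Proof.
elim: N => [|N IH].
  have -> : S 1 = fun=> C by apply/funext => t; rewrite /S big_ord1 u0.
  apply: eq_mxderiv (mxderiv_cst _) _ => t.
  by rewrite /S big_ord0 mulmx0.
have -> : S N.+2 = fun t => S N.+1 t + u N.+1 t by apply/funext => t; exact: SS.
by apply: eq_mxderiv (mxderivD IH (u_deriv N)) _ => t; rewrite SS mulmxDr.
Qed.

Let S_at0 N : S N.+1 0 = C.
Proof.
elim: N => [|N IH]; first by rewrite /S big_ord1 u0.
by rewrite SS IH uS0 addr0.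
Qed.

(** Integrating repeatedly gives entries of [u k t] at most b (c|t|)^k / k!, so for |t| <= T the
    tails are dominated uniformly by those of the exponential series at c T. *)
Let tail (T : R) : exists2 r : nat -> R, r @ \oo --> (0 : R) &
  forall N N' (t : R) i j, (N <= N')%N -> `|t| <= T ->
    `|S N' t i j - S N t i j| <= r N.
Proof.
have [c c0 cP] := mulmx_locally_bounded T.
have [b b0 Cb] : exists2 b : R, 0 <= b & forall i j, `|C i j| <= b.
  exists `|C| => // i j; rewrite [leRHS]/Num.Def.normr/= mx_normrE.
  exact: (@le_bigmax _ _ _ _ (fun i => `|C i.1 i.2|) (i, j)).
have ub k (t : R) i j : `|t| <= T ->
    `|u k t i j| <= b * (c ^+ k * `|t| ^+ k / k`!%:R).
  elim: k t i j => [|k IH] t i j tT.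
    by rewrite u0 fact0 !expr0 mulr1 divr1 mulr1 Cb.
  have := @norm_increment_le R (fun s => u k.+1 s i j)
    (fun s => (P s *m u k s) i j) (b * (c ^+ k.+1 / k`!%:R)) t k.
  rewrite uS0 mxE subr0 => H; apply: le_trans (H _ _) _.
  - by move=> s _; apply: u_deriv.
  - move=> s st; have sT := le_trans st tT.
    apply: le_trans (cP _ _ _ sT (fun i j => IH s i j sT) i j) _.
    by rewrite exprS le_eqVlt; apply/orP; left; apply/eqP; ring.
  - rewrite le_eqVlt factS natrM invfM; apply/orP; left; apply/eqP; ring.
pose e := exp_coeff (c * T).
pose r N := b * (limn (series e) - series e N).
have e_cvg : cvgn (series e) := is_cvg_series_exp_coeff (c * T).
exists r.
  rewrite -[X in _ --> X](mulr0 b) -(subrr (limn (series e))).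
  by apply: cvgMr; apply: cvgB => //; exact: cvg_cst.
move=> N N' t i j NN' tT.
have T0 : 0 <= T := le_trans (normr_ge0 t) tT.
apply: (@le_trans _ _ (b * (series e N' - series e N))); last first.
  apply: ler_wpM2l => //; apply: lerB => //; apply: nondecreasing_cvgn_le => //.
  apply/nondecreasing_seqP => k; rewrite !seriesEnat /= big_nat_recr //= lerDl.
  by apply: exp_coeff_ge0; exact: mulr_ge0.
elim: N' NN' => [|N' IH].
  by rewrite leqn0 => /eqP ->; rewrite !subrr normr0 mulr0.
rewrite leq_eqVlt => /predU1P[->|]; first by rewrite !subrr normr0 mulr0.
rewrite ltnS => /IH {}IH.
rewrite SS mxE addrAC; apply: le_trans (ler_normD _ _) _.
have -> : series e N'.+1 = series e N' + e N'.
  by rewrite !seriesEnat /= big_nat_recr.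
rewrite addrAC mulrDr.
apply: lerD => //; apply: le_trans (ub _ _ _ _ tT) _.
rewrite ler_wpM2l // /e /exp_coeff /= exprMn -!mulrA.
rewrite ler_wpM2l ?exprn_ge0 // ler_wpM2r ?invr_ge0 // lerXn2r ?nnegrE //.
Qed.

Let M (t : R) : 'M[R]_(m, n) := \matrix_(i, j) limn (fun N => S N t i j).

Let S_cvg t i j : (fun N => S N t i j) @ \oo --> M t i j.
Proof.
rewrite mxE; apply: cauchy_cvg; apply: cauchy_exP => e e0.
have [r r0 Sr] := tail `|t|.
move/cvgrPdist_lt : r0 => /(_ _ e0) [N _ Nr].
exists (S N t i j); exists N => // N' NN'; rewrite /= -ball_normE /ball_ /=.
rewrite distrC; apply: le_lt_trans (Sr _ _ _ _ _ NN' _) _ => //.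
by apply: le_lt_trans (Nr N _); rewrite //= sub0r normrN ler_norm.
Qed.

Let M_tail (T : R) : exists2 r : nat -> R, r @ \oo --> (0 : R) &
  forall N (t : R) i j, `|t| <= T -> `|M t i j - S N t i j| <= r N.
Proof.
have [r r0 Sr] := tail T; exists r => // N t i j tT.
have cv : (fun N' => `|S N' t i j - S N t i j|) @ \oo -->
    `|M t i j - S N t i j|.
  by apply: cvg_norm; apply: cvgB; [exact: S_cvg|exact: cvg_cst].
rewrite -(cvg_lim _ cv) //; apply: limr_le; first exact: cvgP cv.
by exists N => // N' NN'; exact: Sr.
Qed.

(** A locally uniform limit of continuous functions, by splitting the error into thirds. *)
Let M_cont i j : continuous (fun t => M t i j).
Proof.
move=> t; apply/cvgrPdist_lt => e e0.
have [r r0 Mr] := M_tail (`|t| + 1).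
have e3 : 0 < e / 3 by rewrite divr_gt0.
move/cvgrPdist_lt : r0 => /(_ _ e3) [N _ /(_ N.+1) Nr].
have {}Nr : r N.+1 < e / 3.
  by apply: le_lt_trans (Nr _) => //=; rewrite sub0r normrN ler_norm.
have Sc := is_derive_continuous (S_deriv N t i j).
move/cvgrPdist_lt : (Sc) => /(_ _ e3) Sc3.
have t1 : \forall s \near t, `|s| < `|t| + 1.
  have /(_ t) := @norm_continuous _ R; move/cvgr_lt; apply; by rewrite ltrDl.
near=> s.
have s1 : `|s| <= `|t| + 1 by apply: ltW; near: s.
have Ss : `|S N.+1 t i j - S N.+1 s i j| < e / 3 by near: s.
have Mt := Mr N.+1 t i j _; have Ms := Mr N.+1 s i j s1.
have {}Mt : `|M t i j - S N.+1 t i j| <= r N.+1 by apply: Mt; rewrite lerDl.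
move: Ss Mt Ms; rewrite !ltr_norml !ler_norml; lra.
Unshelve. all: by end_near. Qed.

Let M_at0 : M 0 = C.
Proof.
apply/matrixP => i j; rewrite mxE; apply: cvg_lim => //.
apply: cvg_near_cst.
by exists 1%N => // -[//|N] _ /=; rewrite S_at0.
Qed.

(** The limit is not differentiated directly. With [W] the primitive of P M vanishing at 0, one
    shows M = C + W: [S N.+1] is close to [M] by the tail bound and close to C + W because its
    derivative P S_N is close to P M. *)
Let M_deriv : mxderiv M (fun t => P t *m M t).
Proof.
have [W W0 Wd] := mx_antiderivative (continuous_mulmx P_cont M_cont).
have WE t i j : M t i j = C i j + W t i j.
  have [c c0 cP] := mulmx_locally_bounded `|t|.
  have [r r0 Mr] := M_tail `|t|.
  have WS N : `|M t i j - (C i j + W t i j)| <= c * r N * `|t| + r N.+1.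
    have := @norm_increment_le R ((fun s => W s i j) - (fun s => S N.+1 s i j))
      (fun s => (P s *m M s) i j - (P s *m S N s) i j) (c * r N) t 0%N.
    rewrite -![(_ - _ : R -> R) _]/(W _ i j - S N.+1 _ i j) W0 S_at0 mxE.
    rewrite expr1 divr1 => /(_ _ _)/le_trans WSN.
    have := Mr N.+1 t i j (lexx _).
    have : `|W t i j - S N.+1 t i j - (0 - C i j)| <= c * r N * `|t|.
      apply: WSN => // s st.
        by apply: is_deriveB; [exact: Wd|exact: S_deriv].
      rewrite expr0 mulr1.
      have -> : (P s *m M s) i j - (P s *m S N s) i j =
          (P s *m (M s - S N s)) i j.
        by rewrite mulmxBr !mxE.
      apply: cP => // k l; rewrite !mxE; have := Mr N s k l st; by rewrite !mxE.
    rewrite !ler_norml; lra.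
  apply/eqP; rewrite -subr_eq0 -normr_le0.
  have : (fun N => c * r N * `|t| + r N.+1) @ \oo --> (c * 0 * `|t| + 0 : R).
    apply: cvgD; last by rewrite cvg_shiftS.
    by apply: cvgMl; apply: cvgMr.
  rewrite mulr0 mul0r addr0 => cv.
  rewrite -(cvg_lim _ cv) //; apply: limr_ge; first exact: cvgP cv.
  by exists 0%N.
move=> t i j.
rewrite (_ : (fun t => _) = cst (C i j) + fun t => W t i j).
  rewrite -[X in is_derive _ _ _ X]add0r.
  by apply: is_deriveD; exact: Wd.
by apply/funext => s; rewrite WE.
Qed.

(** The convergence is exported with the solution, so that the limit can be recognized as a given
    series. *)
Lemma picard_series : exists2 M : R -> 'M[R]_(m, n),
  M 0 = C /\ mxderiv M (fun t => P t *m M t) &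
  forall t i j, (fun N => (\sum_(k < N) u k t) i j) @ \oo --> M t i j.
Proof. by exists M. Qed.

End Picard.

Section LinearODE.
Context {R : realType}.

Lemma linear_ode {m n} (P : R -> 'M[R]_m) (C : 'M[R]_(m, n)) :
  (forall i j, continuous (fun t => P t i j)) ->
  exists2 M, M 0 = C & mxderiv M (fun t => P t *m M t).
Proof.
move=> Pc.
(* Each iterate carries its continuity, which is what allows the next primitive to be taken. *)
pose D := {v : R -> 'M[R]_(m, n) | forall i j, continuous (fun t => v t i j)}.
have stepP (v : D) : exists w : D, sval w 0 = 0 /\
    mxderiv (sval w) (fun t => P t *m sval v t).
  have [w w0 wd] := mx_antiderivative (continuous_mulmx Pc (svalP v)).
  have wc i j : continuous (fun t => w t i j) := mxderiv_continuous wd.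
  by exists (exist _ w wc).
pose step (v : D) := projT1 (cid (stepP v)).
have Cc (i : 'I_m) (j : 'I_n) : continuous (fun t : R => (fun=> C) t i j).
  by move=> t; exact: cvg_cst.
pose u k := sval (iter k step (exist _ (fun=> C) Cc)).
have uS k : u k.+1 0 = 0 /\ mxderiv (u k.+1) (fun t => P t *m u k t).
  by rewrite {1 2}/u iterS; exact: projT2 (cid (stepP _)).
have [//|k|k|M [M0 Md] _] := @picard_series R m n P u C Pc; last by exists M.
- by have [] := uS k.
- by have [] := uS k.
Qed.

End LinearODE.

(** * The matrix exponential and constant coefficient equations *)

Section Exponential.
Context {R : realType} {m : nat}.
Implicit Types (X : 'M[R]_m) (t : R).

Let coef X k t : 'M[R]_m := (k`!%:R)^-1 *: (t *: X) ^+ k.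

Let coefS X k t : coef X k.+1 t = (t / k.+1%:R) *: (X *m coef X k t).
Proof.
rewrite /coef exprS -[_ * _]/(_ *m _) -scalemxAl -!scalemxAr !scalerA.
rewrite factS natrM.
by congr (_ *: _); field; rewrite addrC natr1 !pnatr_eq0 -lt0n fact_gt0.
Qed.

Let coefE X k t : coef X k t = (t ^+ k / k`!%:R) *: X ^+ k.
Proof.
elim: k => [|k IH]; first by rewrite /coef !expr0 divr1 invr1 !scale1r.
rewrite coefS IH -scalemxAr scalerA -[X *m _]/(X * _) -exprS.
rewrite factS natrM [t ^+ _.+1]exprS.
by congr (_ *: _); field; rewrite addrC natr1 !pnatr_eq0 -lt0n fact_gt0.
Qed.

Let coef_deriv X k : mxderiv (coef X k.+1) (fun t => X *m coef X k t).
Proof.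
have -> : coef X k.+1 = fun t => (t ^+ k.+1 / (k.+1)`!%:R) *: X ^+ k.+1.
  by apply/funext => t; rewrite coefE.
move=> t i j; rewrite coefE -scalemxAr -[X *m _]/(X * _) -exprS mxE.
rewrite [X in is_derive _ _ X _](_ : _ =
  ((X ^+ k.+1) i j / (k.+1)`!%:R) *: (id : R -> R) ^+ k.+1); last first.
  by apply/funext => u; rewrite mxE -[RHS]/(_ * _) fctE; ring.
apply: is_derive_eq; rewrite /GRing.scale /= mulr1 factS natrM.
by field; rewrite addrC natr1 !pnatr_eq0 -lt0n fact_gt0.
Qed.

Let coef0 X t : coef X 0 t = 1%:M.
Proof. by rewrite /coef expr0 invr1 scale1r. Qed.

Let coefS0 X k : coef X k.+1 0 = 0.
Proof. by rewrite coefS mul0r scale0r. Qed.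

Lemma cvg_mx {p q} (U : nat -> 'M[R]_(p, q)) (L : 'M[R]_(p, q)) :
  (forall i j, (fun N => U N i j) @ \oo --> L i j) -> U @ \oo --> L.
Proof.
move=> UL; apply/cvgrPdist_le => /= e e0; near=> N.
rewrite /Num.Def.normr/= mx_normrE (bigmax_le _ (ltW e0))//= => i _.
rewrite !mxE/=.
move: i; near: N; apply: filter_forall => /= i.
exact: ((cvgrPdist_le _ _).1 (UL i.1 i.2)).
Unshelve. all: by end_near. Qed.

(** The terms of the exponential series at t X are the Picard increments for M' = X M with M(0) = 1,
    which gives the value at 0 and the derivative with [X] on the left. *)
Lemma expmx_spec X : [/\ expmx (0 *: X) = 1%:M,
  mxderiv (fun t => expmx (t *: X)) (fun t => X *m expmx (t *: X)) &
  mxderiv (fun t => expmx (t *: X)) (fun t => expmx (t *: X) *m X)].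
Proof.
have cst_cont (Y : 'M[R]_m) i j : continuous (fun t : R => (fun=> Y) t i j).
  by move=> t; exact: cvg_cst.
have [M [M0 Md] Mcv] := @picard_series R m m (fun=> X) (coef X) 1%:M
  (cst_cont X) (coef0 X) (coefS0 X) (coef_deriv X).
have ME t : expmx (t *: X) = M t.
  apply: cvg_lim => //; apply: cvg_mx => i j.
  rewrite (_ : (fun N => _) = fun N => (\sum_(k < N) coef X k t) i j).
    exact: Mcv.
  by apply/funext => N; rewrite /series /= big_mkord.
(* The transposed terms are the Picard increments for the transpose of [X]; transposing their sum
   back puts [X] on the right. *)
have [|||M' [M'0 M'd] M'cv] := @picard_series R m m (fun=> X^T)
   (fun k t => (coef X k t)^T) 1%:M (cst_cont X^T).
- by move=> t; rewrite coef0 trmx1.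
- by move=> k; rewrite coefS0 trmx0.
- move=> k; apply: eq_mxderiv (mxderiv_tr (coef_deriv X k)) _ => t.
  rewrite -trmx_mul; congr (_^T).
  rewrite coefE -scalemxAl -scalemxAr -[X *m _]/(X * _) -[_ *m X]/(_ * X).
  by rewrite -exprSr exprS.
have M'E t : M' t = (M t)^T.
  apply/matrixP => i j; rewrite mxE.
  apply: cvg_unique (M'cv t i j) _ => //.
  rewrite (_ : (fun N => _) = fun N => (\sum_(k < N) coef X k t) j i).
    exact: Mcv.
  by apply/funext => N; rewrite -raddf_sum mxE.
have eM : (fun t => expmx (t *: X)) = M by apply/funext => t; exact: ME.
split; first by rewrite ME.
  by rewrite eM; apply: eq_mxderiv Md _ => t; rewrite ME.
have := mxderiv_tr M'd.
rewrite (_ : (fun t => (M' t)^T) = M); last first.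
  by apply/funext => t; rewrite M'E trmxK.
by rewrite eM => /eq_mxderiv; apply=> t; rewrite trmx_mul trmxK M'E trmxK ME.
Qed.

Lemma expmx_derivl X :
  mxderiv (fun t => expmx (t *: X)) (fun t => X *m expmx (t *: X)).
Proof. by have [] := expmx_spec X. Qed.

Lemma expmx_derivr X :
  mxderiv (fun t => expmx (t *: X)) (fun t => expmx (t *: X) *m X).
Proof. by have [] := expmx_spec X. Qed.

Lemma expmx0 X : expmx (0 *: X) = 1%:M.
Proof. by have [] := expmx_spec X. Qed.

(** The product has derivative zero: differentiating the left factor with -X on its right and the
    right factor with X on its left gives two opposite terms. *)
Lemma expmxNM X t : expmx (- t *: X) *m expmx (t *: X) = 1%:M.
Proof.
have eN s : expmx (- s *: X) = expmx (s *: - X) by rewrite scaleNr scalerN.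
transitivity (expmx (0 *: - X) *m expmx (0 *: X)); last first.
  by rewrite !expmx0 mulmx1.
rewrite eN.
apply: (@mxderiv0_cst _ _ _ (fun s => expmx (s *: - X) *m expmx (s *: X))).
apply: eq_mxderiv (mxderivM (expmx_derivr (- X)) (expmx_derivl X)) _ => s.
by rewrite mulmxN mulNmx mulmxA addNr.
Qed.

Lemma expmxMN X t : expmx (t *: X) *m expmx (- t *: X) = 1%:M.
Proof. by have := expmxNM X (- t); rewrite opprK. Qed.

(** Uniqueness of solutions: exp(-tX) M(t) has derivative zero. *)
Lemma expmx_ode {n} X (M : R -> 'M[R]_(m, n)) :
  mxderiv M (fun t => X *m M t) -> forall t, M t = expmx (t *: X) *m M 0.
Proof.
move=> Md t.
have eN s : expmx (- s *: X) = expmx (s *: - X) by rewrite scaleNr scalerN.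
suff : expmx (- t *: X) *m M t = M 0.
  by move=> <-; rewrite mulmxA expmxMN mul1mx.
transitivity (expmx (0 *: - X) *m M 0); last by rewrite expmx0 mul1mx.
rewrite eN; apply: (@mxderiv0_cst _ _ _ (fun s => expmx (s *: - X) *m M s)).
apply: eq_mxderiv (mxderivM (expmx_derivr (- X)) Md) _ => s.
by rewrite mulmxN mulNmx mulmxA addNr.
Qed.

End Exponential.

Lemma expmx_ode_r {R : realType} {m n} (K : 'M[R]_m) (M : R -> 'M[R]_(n, m)) :
  mxderiv M (fun t => M t *m K) -> forall t, M t = M 0 *m expmx (t *: K).
Proof.
move=> Md t.
suff : M t *m expmx (- t *: K) = M 0.
  by move=> <-; rewrite -mulmxA expmxNM mulmx1.
transitivity (M 0 *m expmx (0 *: - K)); last by rewrite expmx0 mulmx1.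
rewrite scaleNr -scalerN.
apply: (@mxderiv0_cst _ _ _ (fun s => M s *m expmx (s *: - K))).
apply: eq_mxderiv (mxderivM Md (expmx_derivl (- K))) _ => s.
by rewrite mulNmx mulmxN !mulmxA subrr.
Qed.

(** Both sides solve W' = W K with W(0) = G. *)
Lemma expmx_intertwine {R : realType} {m n} (Z : 'M[R]_m) (K : 'M[R]_n)
    (G : 'M[R]_(m, n)) (t : R) :
  Z *m G = G *m K -> expmx (t *: Z) *m G = G *m expmx (t *: K).
Proof.
move=> ZG; have Wd : mxderiv (fun s => expmx (s *: Z) *m G)
    (fun s => expmx (s *: Z) *m G *m K).
  apply: eq_mxderiv (mxderivM (expmx_derivr Z) (mxderiv_cst G)) _ => s.
  by rewrite mulmx0 addr0 -!mulmxA ZG.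
by rewrite (expmx_ode_r Wd) expmx0 mul1mx.
Qed.

(** * Smooth matrix curves *)

Section Smoothness.
Context {R : realType}.

(** Counts successive derivatives, peeling off the innermost one, so that closure under sums,
    products and inverses follows by induction on [k]; asking it for all [k] is smoothness. *)
Fixpoint Ck (k : nat) (f : R -> R) : Prop :=
  if k is k'.+1 then (forall t : R, derivable f t 1) /\ Ck k' (derive1 f)
  else True.

Lemma CkW k f : Ck k.+1 f -> Ck k f.
Proof. by elim: k f => // k IH f [fd /IH]. Qed.

Lemma Ck_cst k (a : R) : Ck k (fun=> a).
Proof.
elim: k a => //= k IH a; split; first by move=> t; exact: derivable_cst.
rewrite (_ : derive1 _ = fun=> 0); first exact: IH.
by apply/funext => t; rewrite derive1E derive_cst.
Qed.

Lemma CkD k f g : Ck k f -> Ck k g -> Ck k (fun t => f t + g t).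
Proof.
elim: k f g => //= k IH f g [fd fk] [gd gk].
split; first by move=> t; apply: derivableD; [exact: fd|exact: gd].
rewrite (_ : derive1 _ = fun t => derive1 f t + derive1 g t); first exact: IH.
by apply/funext => t; rewrite !derive1E deriveD.
Qed.

Lemma CkM k f g : Ck k f -> Ck k g -> Ck k (fun t => f t * g t).
Proof.
elim: k f g => //= k IH f g fS gS.
have [[fd fk] [gd gk]] := (fS, gS).
split; first by move=> t; apply: derivableM; [exact: fd|exact: gd].
rewrite (_ : derive1 _ = fun t => f t * derive1 g t + g t * derive1 f t).
  by apply: CkD; apply: IH => //; apply: CkW.
by apply/funext => t; rewrite !derive1E deriveM.
Qed.

Lemma Ck_inv k f : (forall t, f t != 0) -> Ck k f -> Ck k (fun t => (f t)^-1).
Proof.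
move=> f0; elim: k => //= k IH fS; have [fd fk] := fS.
split; first by move=> t; apply: derivableV.
rewrite (_ : derive1 _ = fun t => -1 * ((f t)^-1 * ((f t)^-1 * derive1 f t))).
  have VS := IH (CkW fS).
  by apply: CkM (Ck_cst _ _) (CkM VS (CkM VS fk)).
apply/funext => t; rewrite !derive1E deriveV// mulN1r /GRing.scale /=.
by rewrite mulrA -expr2 exprVn mulNr.
Qed.

Lemma Ck_sum k (I : Type) (r : seq I) (P : pred I) (F : I -> R -> R) :
  (forall i, Ck k (F i)) -> Ck k (fun t => \sum_(i <- r | P i) F i t).
Proof.
move=> FS; rewrite (_ : (fun t => _) = fun t => (\sum_(i <- r | P i) F i) t).
  by elim/big_ind : _ => // *; [exact: Ck_cst|exact: CkD].
by apply/funext => t; rewrite fct_sumE.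
Qed.

Lemma Ck_prod k (I : Type) (r : seq I) (P : pred I) (F : I -> R -> R) :
  (forall i, Ck k (F i)) -> Ck k (fun t => \prod_(i <- r | P i) F i t).
Proof.
move=> FS; rewrite (_ : (fun t => _) = fun t => (\prod_(i <- r | P i) F i) t).
  by elim/big_ind : _ => // *; [exact: Ck_cst|exact: CkM].
by apply/funext => t; rewrite fct_prodE.
Qed.

Definition mxCk {m n} k (F : R -> 'M[R]_(m, n)) : Prop :=
  forall i j, Ck k (fun t => F t i j).

Lemma mxCkM {m n p} k (F : R -> 'M[R]_(m, n)) (G : R -> 'M[R]_(n, p)) :
  mxCk k F -> mxCk k G -> mxCk k (fun t => F t *m G t).
Proof.
move=> FS GS i j.
rewrite (_ : (fun t => _) = fun t => \sum_k F t i k * G t k j).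
  by apply: Ck_sum => l; exact: CkM.
by apply/funext => t; rewrite mxE.
Qed.

Lemma Ck_det {n} k (F : R -> 'M[R]_n) : mxCk k F -> Ck k (fun t => \det (F t)).
Proof.
move=> FS; apply: Ck_sum => s; apply: CkM; first exact: Ck_cst.
exact: Ck_prod.
Qed.

(** By Cramer's rule the entries of the inverse are signed minors divided by the determinant. *)
Lemma mxCk_inv {n} k (F : R -> 'M[R]_n) : (forall t, F t \in unitmx) ->
  mxCk k F -> mxCk k (fun t => invmx (F t)).
Proof.
move=> Fu FS i j.
rewrite (_ : (fun t => _) = fun t => (\det (F t))^-1 *
    ((-1) ^+ (j + i) * \det (row' j (col' i (F t))))); last first.
  by apply/funext => t; rewrite /invmx Fu !mxE.
apply: CkM; first apply: Ck_inv.
- by move=> t; have := Fu t; rewrite unitmxE unitfE.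
- exact: Ck_det.
apply: CkM; first exact: Ck_cst.
apply: Ck_det => l p.
rewrite (_ : (fun t => _) = fun t => F t (lift j l) (lift i p)) //.
by apply/funext => t; rewrite !mxE.
Qed.

Lemma mxCkS {m n} k (F F' : R -> 'M[R]_(m, n)) :
  mxderiv F F' -> mxCk k.+1 F <-> mxCk k F'.
Proof.
move=> Fd.
have dE i j : derive1 (fun t => F t i j) = fun t => F' t i j.
  by apply/funext => t; rewrite derive1E; have [] := Fd t i j.
split=> FS i j; first by have [_] := FS i j; rewrite dE.
by split; [move=> t; have [] := Fd t i j|rewrite dE; exact: FS].
Qed.

Lemma mxCk1 {m n} (F : R -> 'M[R]_(m, n)) : mxCk 1 F -> mxderiv F (derive1 F).
Proof.
move=> FS; apply/mxderivP; split=> // t; apply/derivable_mxP => i j.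
by have [] := FS i j.
Qed.

Lemma smooth_deriv {m n} (F : R -> 'M[R]_(m, n)) :
  smooth F -> mxderiv F (derive1 F) /\ smooth (derive1 F).
Proof.
move=> FS; split; first by apply/mxderivP; split=> // t; exact: (FS 0).
by move=> k t; have := FS k.+1 t; rewrite /derive1n iterSr.
Qed.

Lemma smooth_mxCkP {m n} (F : R -> 'M[R]_(m, n)) :
  smooth F <-> forall k, mxCk k F.
Proof.
split=> [FS k|FS k].
  by elim: k F FS => // k IH F /smooth_deriv[Fd /IH /(mxCkS k Fd)].
elim: k F FS => [|k IH] F FS.
  by have /mxderivP[] := mxCk1 (FS 1).
rewrite /derive1n iterSr; apply: IH => k'.
by apply/(mxCkS k' (mxCk1 (FS 1))).
Qed.

Lemma smoothM {m n p} (F : R -> 'M[R]_(m, n)) (G : R -> 'M[R]_(n, p)) :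
  smooth F -> smooth G -> smooth (fun t => F t *m G t).
Proof.
move=> /smooth_mxCkP FS /smooth_mxCkP GS; apply/smooth_mxCkP => k.
exact: mxCkM.
Qed.

Lemma smooth_invmx {n} (F : R -> 'M[R]_n) : (forall t, F t \in unitmx) ->
  smooth F -> smooth (fun t => invmx (F t)).
Proof.
by move=> Fu /smooth_mxCkP FS; apply/smooth_mxCkP => k; exact: mxCk_inv.
Qed.

Lemma smooth_cst {m n} (C : 'M[R]_(m, n)) : smooth (fun=> C : 'M[R]_(m, n)).
Proof. by apply/smooth_mxCkP => k i j; exact: Ck_cst. Qed.

Lemma smoothZ {m n} (a : R) (F : R -> 'M[R]_(m, n)) :
  smooth F -> smooth (fun t => a *: F t).
Proof.
move=> /smooth_mxCkP FS; apply/smooth_mxCkP => k i j.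
rewrite (_ : (fun t => _) = fun t => a * F t i j).
  exact: CkM (Ck_cst k a) (FS k i j).
by apply/funext => t; rewrite mxE.
Qed.

Lemma smooth_row {m n p} (F : R -> 'M[R]_(m, n)) (G : R -> 'M[R]_(m, p)) :
  smooth F -> smooth G -> smooth (fun t => row_mx (F t) (G t)).
Proof.
move=> /smooth_mxCkP FS /smooth_mxCkP GS; apply/smooth_mxCkP => k i j.
case: (split_ordP j) => l ->.
  rewrite (_ : (fun t => _) = fun t => F t i l); first exact: FS.
  by apply/funext => t; rewrite row_mxEl.
rewrite (_ : (fun t => _) = fun t => G t i l); first exact: GS.
by apply/funext => t; rewrite row_mxEr.
Qed.

Lemma smooth_usubmx {m n p} (F : R -> 'M[R]_(m + n, p)) :
  smooth F -> smooth (fun t => usubmx (F t)).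
Proof.
move=> /smooth_mxCkP FS; apply/smooth_mxCkP => k i j.
rewrite (_ : (fun t => _) = fun t => F t (lshift n i) j); first exact: FS.
by apply/funext => t; rewrite mxE.
Qed.

Lemma smooth_dsubmx {m n p} (F : R -> 'M[R]_(m + n, p)) :
  smooth F -> smooth (fun t => dsubmx (F t)).
Proof.
move=> /smooth_mxCkP FS; apply/smooth_mxCkP => k i j.
rewrite (_ : (fun t => _) = fun t => F t (rshift m i) j); first exact: FS.
by apply/funext => t; rewrite mxE.
Qed.

(** Bootstrap: k derivatives of [M] give k derivatives of P M = M', hence k + 1 of [M]. *)
Lemma smooth_linear_ode {m n} (P : R -> 'M[R]_m) (M : R -> 'M[R]_(m, n)) :
  smooth P -> mxderiv M (fun t => P t *m M t) -> smooth M.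
Proof.
move=> /smooth_mxCkP PS Md; apply/smooth_mxCkP; elim=> [//|k IH].
by apply/(mxCkS k Md)/mxCkM.
Qed.

Lemma smooth_expmx {m} (X : 'M[R]_m) : smooth (fun t => expmx (t *: X)).
Proof. exact: smooth_linear_ode (@smooth_cst m m X) (expmx_derivl X). Qed.

End Smoothness.

(** * Column spans and normal frames *)

Section ColumnSpan.
Context {R : realType}.

Lemma mem_colspan {m p} (M : 'M[R]_(m, p)) (v : 'cV[R]_m) :
  reflect (exists w, v = M *m w) (v \in colspan M).
Proof.
apply: (iffP idP) => [vM|[w ->]].
  have sM : (colspan M <= limg (linfun (mulmx M : 'cV_p -> 'cV_m)))%VS.
    apply/span_subvP => _ /mapP[j _ ->].
    by rewrite colE -[_ *m _](lfunE (mulmx M)); apply: memv_img (memvf _).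
  by have /memv_imgP[w _ ->] := subvP sM _ vM; exists w; rewrite lfunE.
have -> : M *m w = \sum_j w j 0 *: col j M.
  apply/colP => i; rewrite mxE summxE; apply: eq_bigr => j _.
  by rewrite !mxE mulrC.
apply: memv_suml => j _; apply/memvZ/memv_span/mapP.
by exists j => //; rewrite mem_enum.
Qed.

Lemma cols_in_colspan {m p q} (M : 'M[R]_(m, p)) (N : 'M[R]_(m, q)) :
  (forall j, col j N \in colspan M) -> exists K, N = M *m K.
Proof.
move=> NM; have /choice[w wE] j := mem_colspan _ _ (NM j).
exists (\matrix_(i, j) w j i 0); apply/matrixP => i j.
have /(congr1 (fun c : 'cV_m => c i 0)) := wE j; rewrite !mxE => ->.
by apply: eq_bigr => k _; rewrite mxE.
Qed.

Lemma colspan_factor {m p q} (M : 'M[R]_(m, p)) (N : 'M[R]_(m, q)) :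
  colspan N = colspan M -> exists K, N = M *m K.
Proof.
move=> NM; apply: cols_in_colspan => j; rewrite -NM.
by apply/mem_colspan; exists (delta_mx j 0); rewrite colE.
Qed.

Lemma colspan_mulmx_unit {m p} (M : 'M[R]_(m, p)) (K : 'M[R]_p) :
  K \in unitmx -> colspan (M *m K) = colspan M.
Proof.
move=> Ku; apply/vspaceP => v; apply/mem_colspan/mem_colspan => -[w ->].
  by exists (K *m w); rewrite mulmxA.
by exists (invmx K *m w); rewrite -mulmxA mulKVmx.
Qed.

Lemma mximg_colspan {m p} (X : 'M[R]_m) (M : 'M[R]_(m, p)) :
  mximg X (colspan M) = colspan (X *m M).
Proof.
apply/vspaceP => v; apply/memv_imgP/mem_colspan.
  by move=> [_ /mem_colspan[w ->] ->]; exists w; rewrite lfunE /= mulmxA.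
move=> [w ->]; exists (M *m w); last by rewrite lfunE /= mulmxA.
by apply/mem_colspan; exists w.
Qed.

(** If the two spans fill the space, writing each basis vector in the columns yields a right
    inverse, which suffices for a square matrix; conversely the inverse splits any vector. *)
Lemma transverse_colspan {n} (B C : 'M[R]_(n + n, n)) :
  transverse (colspan C) (colspan B) <-> row_mx B C \in unitmx.
Proof.
split=> [tr|u].
  have /choice[w wE] (j : 'I_(n + n)) :
      exists w, delta_mx j 0 = row_mx B C *m w :> 'cV_(n + n).
    have : delta_mx j 0 \in (colspan C + colspan B)%VS by rewrite tr memvf.
    move=> /memv_addP[_ /mem_colspan[c ->] [_ /mem_colspan[b ->] ->]].
    by exists (col_mx b c); rewrite mul_row_col addrC.
  have /mulmx1_unit[] // : row_mx B C *m (\matrix_(i, j) w j i 0) = 1%:M.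
  apply/matrixP => i j.
  have /(congr1 (fun c : 'cV_(n + n) => c i 0)) := wE j.
  rewrite !mxE eqxx andbT.
  by move=> ->; apply: eq_bigr => k _; congr (_ * _); rewrite mxE.
apply/vspaceP => v; rewrite memvf; apply/memv_addP.
pose w := invmx (row_mx B C) *m v.
exists (C *m dsubmx w); first by apply/mem_colspan; exists (dsubmx w).
exists (B *m usubmx w); first by apply/mem_colspan; exists (usubmx w).
by rewrite addrC -mul_row_col vsubmxK mulKVmx.
Qed.

End ColumnSpan.

Section NormalFrames.
Context {R : realType} {n : nat}.
Implicit Types A : R -> 'M[R]_(n + n, n).

(** Solves (A | A') applied to the stacked (Q, P) equal to -A''; smoothness comes from that of the
    inverse matrix. *)
Lemma fanning_frame_equation A : fanning_frame A ->
  exists P Q, [/\ smooth P, smooth Q & frame_equation A P Q].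
Proof.
move=> [As Au].
have [_ A1s] := smooth_deriv As; have [_ A2s] := smooth_deriv A1s.
pose QP t :=
  -1 *: (invmx (row_mx (A t) (derive1 A t)) *m derive1 (derive1 A) t).
have QPs : smooth QP.
  apply: smoothZ; apply: smoothM => //; apply: smooth_invmx => //.
  exact: smooth_row.
exists (fun t => dsubmx (QP t)), (fun t => usubmx (QP t)); split.
- exact: smooth_dsubmx.
- exact: smooth_usubmx.
move=> t; rewrite -addrA [_ *m dsubmx _ + _]addrC -mul_row_col vsubmxK.
by rewrite /QP -scalemxAr mulKVmx// scaleN1r subrr.
Qed.

Lemma normal_frameP A : normal_frame A ->
  exists K, forall t, derive1n 2 A t = A t *m K t.
Proof.
by move=> [_ An]; have /choice[K KE] t := cols_in_colspan (An t); exists K.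
Qed.

Lemma unit_ublock (M N : 'M[R]_n) : M \in unitmx -> block_mx M N 0 M \in unitmx.
Proof. by rewrite !unitmxE det_ublock unitrM => ->. Qed.

(* In the frame A M the coefficient of the first derivative is 2 M' - P M. *)
Lemma normal_frame_exists A : fanning_frame A ->
  exists2 M : R -> 'M[R]_n, (forall t, M t \in unitmx) &
    normal_frame (fun t => A t *m M t).
Proof.
move=> Af; have [P [Q [Ps Qs AE]]] := fanning_frame_equation Af.
have [As Au] := Af.
have [Ad A1s] := smooth_deriv As; have [A1d _] := smooth_deriv A1s.
have [Pd _] := smooth_deriv Ps.
have Pc i j : continuous (fun t => (2^-1 *: P t) i j).
  exact: mxderiv_continuous (mxderivZ 2^-1 Pd).
(* The adjoint equation N' = -P^T N / 2 is solved as well: N^T M is constant, which proves [M]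
   invertible. *)
have PTc i j : continuous (fun t => (- 2^-1 *: (P t)^T) i j).
  exact: mxderiv_continuous (mxderivZ (- 2^-1) (mxderiv_tr Pd)).
have [M M0 Md] := linear_ode 1%:M Pc.
have [N N0 Nd] := linear_ode 1%:M PTc.
have NM t : (N t)^T *m M t = 1%:M.
  transitivity ((N 0)^T *m M 0); last by rewrite N0 M0 trmx1 mulmx1.
  apply: (@mxderiv0_cst _ _ _ (fun t => (N t)^T *m M t)).
  apply: eq_mxderiv (mxderivM (mxderiv_tr Nd) Md) _ => s.
  rewrite trmx_mul linearZ /= trmxK -!scalemxAr -!scalemxAl -scalemxAr mulmxA.
  by rewrite scaleNr addNr.
have Mu t : M t \in unitmx by have [] := mulmx1_unit (NM t).
have Ms : smooth M := smooth_linear_ode (@smoothZ _ _ _ 2^-1 P Ps) Md.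
have [_ M1s] := smooth_deriv Ms; have [M1d _] := smooth_deriv M1s.
have M1E : derive1 M = fun t => 2^-1 *: P t *m M t by have /mxderivP[] := Md.
have {}Md : mxderiv M (derive1 M) by rewrite M1E.
exists M; first exact: Mu.
have Bd := mxderivM Ad Md.
have B1d := mxderivD (mxderivM A1d Md) (mxderivM Ad M1d).
have /mxderivP[_ B1E] := Bd; have /mxderivP[_ B2E] := B1d.
split; first split.
- exact: smoothM.
- move=> t; rewrite B1E.
  have -> : row_mx (A t *m M t) (derive1 A t *m M t + A t *m derive1 M t) =
      row_mx (A t) (derive1 A t) *m block_mx (M t) (derive1 M t) 0 (M t).
    by rewrite mul_row_block mulmx0 addr0 [in RHS]addrC.
  by rewrite unitmx_mul Au unit_ublock.
move=> t j; rewrite /derive1n /= B1E B2E.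
have -> : derive1 (derive1 A) t = - (derive1 A t *m P t) - A t *m Q t.
  by have := AE t; rewrite -addrA => /eqP; rewrite addr_eq0 opprD => /eqP.
rewrite M1E.
set A1 := derive1 A t; set M2 := derive1 _ t.
(* The two halves A' P M / 2 cancel against -A' P M, leaving a multiple of [A t]. *)
have -> : (- (A1 *m P t) - A t *m Q t) *m M t + A1 *m (2^-1 *: P t *m M t) +
    (A1 *m (2^-1 *: P t *m M t) + A t *m M2) = A t *m (M2 - Q t *m M t).
  rewrite !mulmxDl -!scalemxAl -!scalemxAr !mulNmx mulmxBr !mulmxA.
  set a := A1 *m _ *m _.
  move: a (A t *m M2) (A t *m Q t *m M t) => x y z.
  by apply/matrixP => i k; rewrite !mxE; lra.
apply/mem_colspan; exists (col j (invmx (M t) *m (M2 - Q t *m M t))).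
by rewrite !colE -!mulmxA mulKVmx.
Qed.

End NormalFrames.

(** * Schwarzians of normal frames and orbits of one-parameter groups *)

Section WeaklyParallel.
Context {R : realType} {n : nat}.
Implicit Types (B : R -> 'M[R]_(n + n, n)) (X Y : 'M[R]_n).

(** Normality is a frame equation with P = 0, so uniqueness of the coefficients leaves S = 2 Q. *)
Lemma normal_schwarzian_equation B (S : R -> 'M[R]_n) :
  normal_frame B -> is_schwarzian B S ->
  forall t, derive1n 2 B t = - (2^-1 *: (B t *m S t)).
Proof.
move=> Bn [P [Q [_ _ BE SE]]] t; have [K KE] := normal_frameP Bn.
have BK : frame_equation B (fun=> 0) (fun t => - K t).
  by move=> s; rewrite KE mulmx0 addr0 mulmxN subrr.
have [P0 QK] := frame_equation_inj Bn.1 BE BK.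
have dP : derive1 P t = 0.
  by rewrite P0; have /mxderivP[_ ->] := mxderiv_cst (0 : 'M[R]_n).
rewrite SE dP P0 QK mul0mx scaler0 !subr0 KE -scalemxAr scalerA.
by rewrite mulVf ?pnatr_eq0// scale1r mulmxN opprK.
Qed.

(* D = B exp (- t Y) satisfies D'' = - D' (2 Y) - D (X / 2 + Y ^ 2), a linear
   equation with constant coefficients. *)
Lemma weakly_parallel_frame B X Y : fanning_frame B ->
  (forall t, derive1n 2 B t =
     - (2^-1 *: (B t *m (expmx (- t *: Y) *m X *m expmx (t *: Y))))) ->
  exists2 Z : 'M[R]_(n + n), row_mx (B 0) (Z *m B 0) \in unitmx &
    forall t, colspan (B t) = colspan (expmx (t *: Z) *m B 0).
Proof.
move=> [Bs Bu] BE.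
have [Bd B1s] := smooth_deriv Bs; have [B1d _] := smooth_deriv B1s.
pose e t := expmx (t *: - Y).
have eN t : expmx (- t *: Y) = e t by rewrite /e scaleNr scalerN.
have ed : mxderiv e (fun t => e t *m - Y) := expmx_derivr (- Y).
have e0 : e 0 = 1%:M by exact: expmx0.
pose D t := B t *m e t.
pose D1 t := derive1 B t *m e t - D t *m Y.
have Dd : mxderiv D D1.
  by apply: eq_mxderiv (mxderivM Bd ed) _ => t; rewrite mulmxN mulmxN mulmxA.
have D1d : mxderiv D1
    (fun t => D t *m - (2^-1 *: X + Y *m Y) + D1 t *m (-2 *: Y)).
  have DYd := mxderivZ (-1) (mxderivM Dd (mxderiv_cst Y)).
  have D1E : D1 = fun t => derive1 B t *m e t + -1 *: (D t *m Y).
    by apply/funext => t; rewrite scaleN1r.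
  rewrite {1}D1E.
  apply: eq_mxderiv (mxderivD (mxderivM B1d ed) DYd) _ => t.
  (* The factor exp(tY) of the Schwarzian cancels against exp(-tY), which makes the coefficient
     constant. *)
  have B2 : derive1 (derive1 B) t *m e t = - (2^-1 *: (D t *m X)).
    rewrite [derive1 _ t]BE mulNmx -scalemxAl -eN -!mulmxA.
    by rewrite expmxMN mulmx1 /D -eN !mulmxA.
  have B1 : derive1 B t *m (e t *m - Y) = - (D1 t *m Y) - D t *m Y *m Y.
    by rewrite !mulmxN mulmxA /D1 mulmxBl opprB addrC addKr.
  rewrite B2 B1 mulmx0 addr0 mulmxN mulmxDr -!scalemxAr mulmxA.
  move: (D t *m X) (D1 t *m Y) (D t *m Y *m Y) => x y z.
  by apply/matrixP => i j; rewrite !mxE; lra.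
pose G t := row_mx (D t) (D1 t).
(* Companion matrix of the second order equation: G' = G K for G = (D | D'). *)
pose K : 'M[R]_(n + n) := block_mx 0 (- (2^-1 *: X + Y *m Y)) 1%:M (-2 *: Y).
have Gd : mxderiv G (fun t => G t *m K).
  apply: eq_mxderiv (mxderiv_row Dd D1d) _ => t.
  by rewrite mul_row_block mulmx0 add0r mulmx1.
have G0u : G 0 \in unitmx.
  have -> : G 0 = row_mx (B 0) (derive1 B 0) *m block_mx 1%:M (- Y) 0 1%:M.
    by rewrite mul_row_block /G /D1 /D e0 !mulmx1 mulmx0 addr0 mulmxN addrC.
  by rewrite unitmx_mul Bu unit_ublock ?unitmx1.
(* Conjugating by G(0) turns right multiplication by [K] into left multiplication by a fixed
   transformation. *)
pose Z := G 0 *m K *m invmx (G 0).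
have ZG : Z *m G 0 = G 0 *m K by rewrite /Z mulmxKV.
have D0 : D 0 = B 0 by rewrite /D e0 mulmx1.
exists Z.
  (* The first block column of [K] gives Z D(0) = D'(0), so (B(0) | Z B(0)) is the invertible
     G(0). *)
  have /eq_row_mx[ZD _] : row_mx (Z *m D 0) (Z *m D1 0) = row_mx (D1 0)
      (D 0 *m - (2^-1 *: X + Y *m Y) + D1 0 *m (-2 *: Y)).
    by rewrite -mul_mx_row ZG /G /K mul_row_block mulmx0 add0r mulmx1.
  by rewrite -D0 ZD.
move=> t.
have Gt : G t = expmx (t *: Z) *m G 0.
  by rewrite (expmx_intertwine t ZG); exact: expmx_ode_r.
have [Dt _] : D t = expmx (t *: Z) *m D 0 /\ D1 t = expmx (t *: Z) *m D1 0.
  by apply: eq_row_mx; rewrite -mul_mx_row.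
rewrite -D0 -Dt colspan_mulmx_unit// /e.
by have [] := mulmx1_unit (expmxMN (- Y) t).
Qed.

(** Write A = exp(tX) A(0) M. In the basis (A(0) | X A(0)), normality forces M' = Y M, so M =
    exp(tY), and also determines the Schwarzian. *)
Lemma group_orbit_schwarzian A (X : 'M[R]_(n + n)) : normal_frame A ->
  row_mx (A 0) (X *m A 0) \in unitmx ->
  (forall t, colspan (A t) = colspan (expmx (t *: X) *m A 0)) ->
  exists W Y : 'M[R]_n,
    is_schwarzian A (fun t => expmx (- t *: Y) *m W *m expmx (t *: Y)).
Proof.
move=> An Uu AX; have [K KE] := normal_frameP An.
have [[As _] _] := An.
have [Ad A1s] := smooth_deriv As.
set U := row_mx _ _ in Uu.
(* Coordinates of -X^2 A(0) in the basis [U], so that X^2 A(0) + X A(0) P + A(0) Q = 0. *)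
pose QP := - (invmx U *m (X *m (X *m A 0))).
pose Q := usubmx QP; pose P := dsubmx QP; pose Y := 2^-1 *: P.
have XXA : X *m (X *m A 0) = - (A 0 *m Q) - X *m A 0 *m P.
  by rewrite -opprD -mul_row_col vsubmxK mulmxN opprK mulKVmx.
(* A left inverse of A(0); it expresses [M] by a formula in [A], from which [M] is smooth. *)
pose L := usubmx (invmx U).
have LA : L *m A 0 = 1%:M.
  have /(congr1 (@ulsubmx _ n n n n)) := mulVmx Uu.
  rewrite scalar_mx_block block_mxKul => <-.
  by rewrite -[invmx U]vsubmxK mul_col_row block_mxKul.
pose E t := expmx (t *: X).
pose M t := L *m (expmx (t *: - X) *m A t).
have AE t : A t = E t *m (A 0 *m M t).
  have [N NE] := colspan_factor (AX t).
  have EA : expmx (t *: - X) *m A t = A 0 *m N.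
    by rewrite NE scalerN -scaleNr mulmxA mulmxA expmxNM mul1mx.
  by rewrite /M EA [L *m _]mulmxA LA mul1mx NE mulmxA.
have M0 : M 0 = 1%:M by rewrite /M expmx0 mul1mx.
have Ms : smooth M.
  apply: smoothM (@smooth_cst _ _ _ L) _.
  by apply: smoothM As; exact: smooth_expmx.
have [Md M1s] := smooth_deriv Ms; have [M1d _] := smooth_deriv M1s.
have Ed : mxderiv E (fun t => E t *m X) := expmx_derivr X.
have cM := mxderivM (mxderiv_cst (A 0)).
have cX := mxderivM (mxderiv_cst X).
pose C t := A 0 *m M t.
pose C1 t := A 0 *m derive1 M t.
pose C2 t := A 0 *m derive1 (derive1 M) t.
have Cd : mxderiv C C1.
  by apply: eq_mxderiv (cM _ _ _ Md) _ => t; rewrite mul0mx add0r.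
have C1d : mxderiv C1 C2.
  by apply: eq_mxderiv (cM _ _ _ M1d) _ => t; rewrite mul0mx add0r.
have XCd : mxderiv (fun t => X *m C t) (fun t => X *m C1 t).
  by apply: eq_mxderiv (cX _ _ _ Cd) _ => t; rewrite mul0mx add0r.
have A1E : derive1 A = fun t => E t *m (X *m C t + C1 t).
  have -> : A = fun t => E t *m C t by apply/funext.
  apply: ((mxderivP _ _).1 _).2; apply: eq_mxderiv (mxderivM Ed Cd) _ => t.
  by rewrite mulmxDr mulmxA.
have A2E t : derive1n 2 A t =
    E t *m (X *m (X *m C t) + 2 *: (X *m C1 t) + C2 t).
  rewrite /derive1n /= A1E.
  have /mxderivP[_ ->] := mxderivM Ed (mxderivD XCd C1d).
  rewrite -mulmxA -mulmxDr; congr (_ *m _); rewrite mulmxDr.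
  by rewrite scaler_nat mulr2n !addrA.
have Eu t : E t \in unitmx by have [] := mulmx1_unit (expmxMN X t).
(* This is A'' = A K with exp(tX) cancelled and X^2 A(0) eliminated. Both coordinates then vanish;
   the one along X A(0) is 2 M' - P M. *)
have MQ t : U *m col_mx (derive1 (derive1 M) t - Q *m M t - M t *m K t)
    (2 *: derive1 M t - P *m M t) = 0.
  have := KE t; rewrite A2E {1}AE -[in RHS]mulmxA => /(can_inj (mulKmx (Eu t))).
  rewrite /C /C1 /C2.
  move: (M t) (derive1 M t) (derive1 (derive1 M) t) => m m1 m2.
  rewrite !mulmxA -[X *m X *m A 0]mulmxA XXA => e.
  rewrite /U mul_row_col !mulmxBr -!scalemxAr !mulmxA -e mulmxBl mulNmx.
  move: (A 0 *m Q *m m) (X *m A 0 *m P *m m) => x y.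
  move: (X *m A 0 *m m1) (A 0 *m m2) => z w.
  by apply/matrixP => i j; rewrite !mxE; ring.
have MYK t : derive1 M t = Y *m M t /\
    derive1 (derive1 M) t - Q *m M t - M t *m K t = 0.
  have /(congr1 (mulmx (invmx U))) := MQ t; rewrite mulKmx// mulmx0 -[0]col_mx0.
  move=> /eq_col_mx[-> /eqP]; rewrite subr_eq0 => /eqP PM; split=> //.
  by rewrite /Y -scalemxAl -PM scalerA mulVf ?pnatr_eq0// scale1r.
have M1E : derive1 M = fun t => Y *m M t by apply/funext => t; have [] := MYK t.
have ME t : M t = expmx (t *: Y).
  rewrite -[RHS]mulmx1 -M0; apply: expmx_ode; by rewrite -M1E.
have M2E t : derive1 (derive1 M) t = Y *m (Y *m M t).
  rewrite M1E; have /mxderivP[_ ->] := mxderivM (mxderiv_cst Y) Md.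
  by rewrite mul0mx add0r M1E.
have MK t : M t *m K t = Y *m (Y *m M t) - Q *m M t.
  by have [_ /eqP] := MYK t; rewrite subr_eq0 M2E => /eqP ->.
(* The frame coefficients are 0 and -K, and M K = (Y^2 - Q) M exhibits [K] as a conjugate by
   exp(tY); the Schwarzian is -2 K. *)
exists (2 *: (Q - Y *m Y)), Y, (fun=> 0),
  (fun t => expmx (- t *: Y) *m (Q - Y *m Y) *m expmx (t *: Y)); split.
- exact: smooth_cst.
- have eN : (fun t => expmx (- t *: Y)) = fun t => expmx (t *: - Y).
    by apply/funext => t; rewrite scaleNr scalerN.
  have eNs : smooth (fun t => expmx (- t *: Y)).
    by rewrite eN; exact: smooth_expmx.
  have eQs := smoothM eNs (@smooth_cst _ _ _ (Q - Y *m Y)).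
  exact: smoothM eQs (@smooth_expmx _ _ Y).
- move=> t; rewrite mulmx0 addr0 KE -mulmxDr AE -(mulmxA (E t)) -(mulmxA (A 0)).
  suff -> : M t *m
      (K t + expmx (- t *: Y) *m (Q - Y *m Y) *m expmx (t *: Y)) = 0.
    by rewrite !mulmx0.
  rewrite mulmxDr MK ME !mulmxA expmxMN mul1mx mulmxBl.
  by rewrite addrA subrK subrr.
- move=> t; rewrite mul0mx scaler0 subr0.
  have /mxderivP[_ ->] := mxderiv_cst (0 : 'M[R]_n).
  by rewrite subr0 -scalemxAr -scalemxAl.
Qed.

End WeaklyParallel.

Theorem theorem5p5 (R : realType) (n : nat) (ell : R -> grassmannian R n)
    (ell_fanning : fanning_curve ell) :
  weakly_parallel ell <->
  exists X : 'M[R]_(n + n),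
    transverse (mximg X (ell 0)) (ell 0) /\
    forall t : R, ell t = mximg (expmx (t *: X)) (ell 0) :> {vspace _}.
Proof.
split=> [wp|[X [tr ellX]] A An Aell].
  have [A [Af Aell]] := ell_fanning.
  (* Weak parallelism only constrains normal frames, so one spanning [ell] must be produced
     first. *)
  have [M Mu Bn] := normal_frame_exists Af.
  have Bell : spans (fun t => A t *m M t) ell.
    by move=> t; rewrite colspan_mulmx_unit.
  have [X [Y XY]] := wp _ Bn Bell.
  have BE := normal_schwarzian_equation Bn XY.
  have [Z Zu BZ] := weakly_parallel_frame Bn.1 BE.
  exists Z; rewrite -Bell mximg_colspan; split; first exact/transverse_colspan.
  by move=> t; rewrite -Bell mximg_colspan; exact: BZ.
apply: (group_orbit_schwarzian An (X := X)).
  by apply/transverse_colspan; rewrite -mximg_colspan Aell.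
by move=> t; rewrite Aell ellX -(Aell 0) mximg_colspan.
Qed.
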